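(* Let $s,n_x\ge 1$ be integers and $\tau>0$. Let $A_{\mathrm{RK}}\in\mathbb{R}^{s\times s}$ be an invertible matrix (the coefficient matrix of an $s$-stage Runge--Kutta method), and let $A_{\mathrm{RK}}=U\Sigma V^\top$ be a singular value decomposition, with $U,V\in\mathbb{R}^{s\times s}$ orthogonal and $\Sigma$ diagonal with the singular values of $A_{\mathrm{RK}}$ on its diagonal. Let $M\in\mathbb{R}^{n_x\times n_x}$ be symmetric positive definite (the mass matrix) and $K\in\mathbb{R}^{n_x\times n_x}$ be symmetric positive semi-definite (the stiffness matrix), and set $$\mathcal{P}_{\mathrm{RK}}=(U\otimes I_{n_x})\,(I_s\otimes M+\tau\,\Sigma\otimes K)\,(V^\top\otimes I_{n_x}).$$ Suppose that $$\mathrm{Re}\left(\frac{\mathbf{x}^*(U^\top V)\mathbf{x}}{\mathbf{x}^*\mathbf{x}}\right)>0\qquad\text{for all } \mathbf{x}\in\mathbb{C}^s\setminus\{\mathbf{0}\}.$$ Then the eigenvalues of the matrix $\mathcal{P}_{\mathrm{RK}}^{-1}(I_s\otimes M+\tau A_{\mathrm{RK}}\otimes K)$ all lie in the right half of the unit disk centered at the origin of the complex plane; that is, every eigenvalue $\lambda\in\mathbb{C}$ of this matrix satisfies $\mathrm{Re}(\lambda)>0$ and $|\lambda|\le 1$.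
   Context: $I_m$ denotes the $m\times m$ identity matrix, $\otimes$ the Kronecker product, and $\mathbf{x}^*$ the conjugate transpose of $\mathbf{x}$. The setting is the discretization of the heat equation with Dirichlet boundary conditions by finite elements in space (with $n_x$ degrees of freedom, mass matrix $M$ and stiffness matrix $K$) and by an $s$-stage Runge--Kutta method with coefficient matrix $A_{\mathrm{RK}}=(a_{i,j})_{i,j=1}^s$ and constant time-step $\tau>0$ in time. The matrix $I_s\otimes M+\tau A_{\mathrm{RK}}\otimes K$ is the matrix of the linear system for the Runge--Kutta stages, and $\mathcal{P}_{\mathrm{RK}}$ is its preconditioner. The only properties of $M$ and $K$ involved are that they are real symmetric, with $M$ positive definite and $K$ positive semi-definite. *)

(* Defs.v *)
From mathcomp Require Import all_boot all_order all_algebra.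
From mathcomp Require Export complex.
From mathcomp Require mxtens.

Set Implicit Arguments.
Unset Strict Implicit.
Unset Printing Implicit Defensive.

Import Order.TTheory GRing.Theory Num.Theory.
Local Open Scope ring_scope.

(* Kronecker product. The notations of mxtens are not imported because its    *)
(* [A ^t k] clashes with the [M ^t phi] of sesquilinear.                      *)
Notation "A *t B" := (mxtens.tensmx A B)
  (at level 40, left associativity, format "A  *t  B") : ring_scope.

Section RealMatrices.
Variable R : rcfType.

Definition posdefmx n (M : 'M[R]_n) : Prop :=
  M \is symmetricmx /\
  forall x : 'cV[R]_n, x != 0 -> 0 < (x^T *m M *m x) 0 0.

Definition possemidefmx n (M : 'M[R]_n) : Prop :=
  M \is symmetricmx /\
  forall x : 'cV[R]_n, 0 <= (x^T *m M *m x) 0 0.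

Definition orthogonalmx n (U : 'M[R]_n) : Prop :=
  U *m U^T = 1%:M /\ U^T *m U = 1%:M.

(* No ordering of the singular values is imposed.                             *)
Definition is_svd n (A U Sigma V : 'M[R]_n) : Prop :=
  [/\ orthogonalmx U, orthogonalmx V, is_diag_mx Sigma,
      forall i, 0 <= Sigma i i & A = U *m Sigma *m V^T].

Definition complexmx m n (A : 'M[R]_(m, n)) : 'M[R[i]]_(m, n) :=
  map_mx (real_complex R) A.

Definition rk_matrix s n (tau : R) (A : 'M[R]_s) (M K : 'M[R]_n)
    : 'M[R]_(s * n) :=
  1%:M *t M + tau *: (A *t K).

Definition rk_precond s n (tau : R) (U Sigma V : 'M[R]_s) (M K : 'M[R]_n)
    : 'M[R]_(s * n) :=
  (U *t 1%:M) *m (1%:M *t M + tau *: (Sigma *t K)) *m (V^T *t 1%:M).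

Definition rayleigh n (Q : 'M[R[i]]_n) (x : 'cV[R[i]]_n) : R[i] :=
  (map_mx Num.conj x^T *m Q *m x) 0 0 / (map_mx Num.conj x^T *m x) 0 0.

End RealMatrices.

(* Main.v *)
Require Import Defs.
From mathcomp Require Import all_boot all_order all_algebra.
From mathcomp Require mxtens.

Set Implicit Arguments.
Unset Strict Implicit.
Unset Printing Implicit Defensive.

Import Order.TTheory GRing.Theory Num.Theory.
Local Open Scope ring_scope.

(** Put [Q = U^T V] and [D = I (x) M + tau Sigma (x) K].  Since
    [A = U Sigma V^T] and [U Q V^T = I], the Runge--Kutta matrix and its
    preconditioner [P] share the same invertible outer factors:
      [P = (U (x) I) D (V^T (x) I)],
      [I (x) M + tau A (x) K
         = (U (x) I) (Q (x) M + tau Sigma (x) K) (V^T (x) I)].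
    Hence [lambda] is an eigenvalue of the preconditioned matrix exactly when
    [y (Q (x) M + tau Sigma (x) K) = lambda y D] for some row [y <> 0], and
    multiplying by [y^*] on the right gives [lambda = (q + d) / (m + d)] with
      [q = y (Q (x) M) y^*],  [m = y (I (x) M) y^*],
      [d = tau y (Sigma (x) K) y^*].
    It remains to see that [m > 0], [d >= 0], [Re q > 0] and [|q| <= m]
    ([tens_pencil_eigenvalue]).  The same positivity of [y D y^* = m + d] shows
    that [D], hence the preconditioner, is invertible.

    All four facts come from one formula ([qform_tens_hermitian]).
    Diagonalizing the Hermitian factor [N = W^* diag(nu) W] by a unitary [W]
    cuts [y] into slices [z_j], independent of the left factor, such that
      [y (B (x) N) y^* = sum_j nu_j z_j B z_j^*]
    for every [B].  The weights [nu_j] are values of the form of [N], hence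
    inherit its sign, so the form of [B (x) N] is a nonnegative combination of
    values of the form of [B].  For [B = Q] the Rayleigh hypothesis gives the
    real part and Cauchy--Schwarz the modulus, as [Q] is unitary; for
    [B = Sigma] the singular values are nonnegative. *)

(** * Hermitian forms of row vectors *)

Section QForm.
Local Open Scope sesquilinear_scope.
Context {C : numClosedFieldType}.

(** On rows rather than columns, to be applied to row eigenvectors. *)
Definition qform {n} (N : 'M[C]_n) (y : 'rV[C]_n) : C := (y *m N *m y^t*) 0 0.

Lemma qformE n (N : 'M[C]_n) y : qform N y = dotmx (y *m N) y.
Proof. by rewrite dotmxE. Qed.

Lemma qform1_ge0 n (y : 'rV[C]_n) : 0 <= qform 1%:M y.
Proof. by rewrite qformE mulmx1 dnorm_ge0. Qed.

Lemma qform1_gt0 n (y : 'rV[C]_n) : (0 < qform 1%:M y) = (y != 0).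
Proof. by rewrite qformE mulmx1 dnorm_gt0. Qed.

Lemma qformD n (A B : 'M[C]_n) y : qform (A + B) y = qform A y + qform B y.
Proof. by rewrite /qform mulmxDr mulmxDl mxE. Qed.

Lemma qformZ n a (A : 'M[C]_n) y : qform (a *: A) y = a * qform A y.
Proof. by rewrite /qform -scalemxAr -scalemxAl mxE. Qed.

Lemma qform_ge0 n (N : 'M[C]_n) y :
  (forall z, z != 0 -> 0 < qform N z) -> 0 <= qform N y.
Proof.
move=> N_gt0; have [->|/N_gt0/ltW//] := eqVneq y 0.
by rewrite /qform !mul0mx mxE.
Qed.

Lemma qform_congr m n (B : 'M[C]_(m, n)) N y :
  qform (B *m N *m B^t*) y = qform N (y *m B).
Proof. by rewrite /qform trmx_mul map_mxM !mulmxA. Qed.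

Lemma qform_diag n (d : 'rV[C]_n) y :
  qform (diag_mx d) y = \sum_i d 0 i * `|y 0 i| ^+ 2.
Proof.
rewrite /qform mxE; apply: eq_bigr => i _.
by rewrite mul_mx_diag !mxE normCK mulrAC mulrC.
Qed.

(** Cauchy--Schwarz for [y Q] and [y], which have the same norm. *)
Lemma qform_unitary_le n (Q : 'M[C]_n) y :
  Q \is unitarymx -> `|qform Q y| <= qform 1%:M y.
Proof.
move=> Qu; rewrite !qformE mulmx1.
have CS : `|dotmx (y *m Q) y|
    <= sqrtC (dotmx (y *m Q) (y *m Q)) * sqrtC (dotmx y y).
  exact: leif_le (CauchySchwarz_sqrt _ _ _).
apply: le_trans CS _.
have -> : dotmx (y *m Q) (y *m Q) = dotmx y y.
  by rewrite !dotmxE trmx_mul map_mxM !mulmxA mulmxtVK.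
by rewrite -expr2 sqrtCK.
Qed.

Lemma qform_gt0_unit n (N : 'M[C]_n) :
  (forall z, z != 0 -> 0 < qform N z) -> N \in unitmx.
Proof.
move=> Ngt0; rewrite -row_free_unit -kermx_eq0; apply/rowV0P => z.
move=> /sub_kermxP zN; apply/eqP; apply: contraT => /Ngt0.
by rewrite /qform zN mul0mx mxE ltxx.
Qed.

(** * Forms of Kronecker products with a Hermitian right factor *)

(** Row vectors of length [s * n] are [s x n] matrices in disguise; this is the
    [j]-th column, laid out as a row. *)
Definition tens_slice {s n} (y : 'rV[C]_(s * n)) (j : 'I_n) : 'rV[C]_s :=
  \row_i y 0 (mxtens.mxtens_index (i, j)).

Lemma tens_slice_eq0 s n (y : 'rV[C]_(s * n)) :
  (forall j, tens_slice y j = 0) -> y = 0.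
Proof.
move=> y0; apply/rowP=> k; case: (mxtens.mxtens_indexP k) => i j.
by have /rowP/(_ i) := y0 j; rewrite !mxE.
Qed.

Lemma tensmx11 s n : (1%:M : 'M[C]_s) *t (1%:M : 'M[C]_n) = 1%:M.
Proof.
apply/matrixP=> i j.
case: (mxtens.mxtens_indexP i)=> i1 i2; case: (mxtens.mxtens_indexP j)=> j1 j2.
rewrite mxtens.tensmxE !mxE (can_eq (@mxtens.mxtens_indexK _ _)) xpair_eqE.
by rewrite -natrM mulnb.
Qed.

Lemma tensmx1_unit s n (U : 'M[C]_s) :
  U \in unitmx -> U *t (1%:M : 'M_n) \in unitmx.
Proof.
move=> Uu; suff : (U *t (1%:M : 'M_n)) *m (invmx U *t 1%:M) = 1%:M.
  by case/mulmx1_unit.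
by rewrite mxtens.tensmx_mul mulmxV // mulmx1 tensmx11.
Qed.

(** [Q (x) diag d] never mixes two different slices. *)
Lemma qform_tens_diag s n (Q : 'M[C]_s) (d : 'rV[C]_n) y :
  qform (Q *t diag_mx d) y = \sum_j d 0 j * qform Q (tens_slice y j).
Proof.
have reidx (F : 'I_(s * n) -> C) :
    \sum_k F k = \sum_i \sum_j F (mxtens.mxtens_index (i, j)).
  rewrite pair_big /= (reindex (@mxtens.mxtens_index s n)) /=.
    by apply: eq_bigr => -[].
  exists (@mxtens.mxtens_unindex s n) => k _;
    by rewrite (mxtens.mxtens_indexK, mxtens.mxtens_unindexK).
rewrite /qform mxE reidx exchange_big; apply: eq_bigr => j _ /=.
rewrite mxE mulr_sumr; apply: eq_bigr => i _.
rewrite !mxE mulrA; congr (_ * _); rewrite reidx mulr_sumr.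
apply: eq_bigr => i' _; rewrite (bigD1 j) //= big1 ?addr0 => [|j' j'j].
  by rewrite mxtens.tensmxE !mxE eqxx mulr1n [RHS]mulrC mulrA.
by rewrite mxtens.tensmxE !mxE (negPf j'j) mulr0n !mulr0.
Qed.

Lemma hermitian_spectralE n (N : 'M[C]_n) : N \is hermsymmx ->
  N = (spectralmx N)^t* *m diag_mx (spectral_diag N) *m spectralmx N.
Proof.
move=> /hermitian_normalmx/orthomx_spectralP {1}->.
by rewrite invmx_unitary // spectral_unitarymx.
Qed.

(** The eigenvalues are the values of the form at unit eigenvectors; this is how
    the sign of the form passes to the eigenvalues. *)
Lemma spectral_diag_qform n (N : 'M[C]_n) j : N \is hermsymmx ->
  spectral_diag N 0 j = qform N (row j (spectralmx N)).
Proof.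
move=> /hermitian_spectralE Nh; set P := spectralmx N.
have -> : qform N (row j P) =
    qform (diag_mx (spectral_diag N)) (row j P *m P^t*).
  by rewrite -qform_congr trmxCK -Nh.
rewrite -row_mul (unitarymxP (spectral_unitarymx N)) qform_diag (bigD1 j) //=.
rewrite !mxE eqxx normr1 expr1n mulr1 big1 ?addr0 // => i ij.
by rewrite !mxE eq_sym (negPf ij) normr0 expr0n mulr0.
Qed.

(** The slices of [y] in an orthonormal eigenbasis of a Hermitian [N]. *)
Definition spectral_slice {s n} (N : 'M[C]_n) (y : 'rV[C]_(s * n)) j :=
  tens_slice (y *m (1%:M *t (spectralmx N)^t*)) j.

(** The change of basis [I (x) W^*] that diagonalizes the right factor (with [W] the
    matrix [spectralmx N]) commutes with [Q (x) I], so the slices are the same for every [Q]. *)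
Lemma qform_tens_hermitian s n (Q : 'M[C]_s) (N : 'M[C]_n) y :
  N \is hermsymmx ->
  qform (Q *t N) y =
    \sum_j spectral_diag N 0 j * qform Q (spectral_slice N y j).
Proof.
move=> /hermitian_spectralE {1}->; rewrite -qform_tens_diag -qform_congr.
rewrite mxtens.trmx_tens mxtens.map_mxT trmxCK trmx1 map_mx1.
by rewrite !mxtens.tensmx_mul mul1mx mulmx1.
Qed.

(** The slices determine [y], since [I (x) W^*], with [W] the matrix [spectralmx N], is
    invertible. *)
Lemma spectral_slice_neq0 s n (N : 'M[C]_n) (y : 'rV[C]_(s * n)) :
  y != 0 -> exists j, spectral_slice N y j != 0.
Proof.
move=> y0; apply/existsP; apply: contraNT y0 => /existsPn all0.
have /(congr1 (fun z => z *m (1%:M *t spectralmx N))) :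
    y *m (1%:M *t (spectralmx N)^t*) = 0.
  by apply: tens_slice_eq0 => j; apply/eqP/negPn/all0.
have PtP : (spectralmx N)^t* *m spectralmx N = 1%:M.
  by apply/mulmx1C/unitarymxP/spectral_unitarymx.
by rewrite mul0mx -mulmxA mxtens.tensmx_mul mulmx1 PtP tensmx11 mulmx1 => /eqP.
Qed.

Lemma row_unitarymx_neq0 m n (P : 'M[C]_(m, n)) i :
  P \is unitarymx -> row i P != 0.
Proof.
move=> /row_unitarymxP/(_ i i).
by rewrite -qform1_gt0 qformE mulmx1 eqxx => ->.
Qed.

Lemma qform_tens_ge0 s n (S : 'M[C]_s) (N : 'M[C]_n) y :
    (forall z, 0 <= qform S z) ->
    N \is hermsymmx -> (forall z, 0 <= qform N z) ->
  0 <= qform (S *t N) y.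
Proof.
move=> S_ge0 Nh N_ge0; rewrite qform_tens_hermitian // sumr_ge0 // => j _.
by rewrite mulr_ge0 // spectral_diag_qform.
Qed.

Lemma qform_tens_unitary_le s n (Q : 'M[C]_s) (N : 'M[C]_n) y :
    Q \is unitarymx -> N \is hermsymmx -> (forall z, 0 <= qform N z) ->
  `|qform (Q *t N) y| <= qform (1%:M *t N) y.
Proof.
move=> Qu Nh N_ge0; rewrite !qform_tens_hermitian //.
apply: le_trans (ler_norm_sum _ _ _) _; apply: ler_sum => j _.
rewrite normrM spectral_diag_qform // ger0_norm //.
by rewrite ler_wpM2l ?qform_unitary_le.
Qed.

(** The real part is the sum of the terms [nu_j 'Re w_j], where
    [w_j = z_j Q z_j^*]; they are nonnegative, and positive when the slice [z_j]
    is nonzero. *)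
Lemma Re_qform_tens_gt0 s n (Q : 'M[C]_s) (N : 'M[C]_n) y :
    (forall z, z != 0 -> 0 < 'Re (qform Q z)) ->
    N \is hermsymmx -> (forall z, z != 0 -> 0 < qform N z) ->
  y != 0 -> 0 < 'Re (qform (Q *t N) y).
Proof.
move=> Qgt0 Nh Ngt0 y0; have d_gt0 j : 0 < spectral_diag N 0 j.
  rewrite spectral_diag_qform // Ngt0 // row_unitarymx_neq0 //.
  exact: spectral_unitarymx.
have ReE j : 'Re (spectral_diag N 0 j * qform Q (spectral_slice N y j))
    = spectral_diag N 0 j * 'Re (qform Q (spectral_slice N y j)).
  by rewrite ReMl // gtr0_real.
have term_ge0 j :
    0 <= 'Re (spectral_diag N 0 j * qform Q (spectral_slice N y j)).
  rewrite ReE; have [->|z0] := eqVneq (spectral_slice N y j) 0.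
    by rewrite /qform !mul0mx mxE raddf0 mulr0.
  by rewrite ltW // mulr_gt0 // Qgt0.
have [j zj0] := spectral_slice_neq0 N y0.
rewrite qform_tens_hermitian // raddf_sum (bigD1 j) //= ltr_pwDl ?sumr_ge0 //.
by rewrite ReE mulr_gt0 // Qgt0.
Qed.

(** Positivity of the denominator of [lambda]; it also makes the preconditioner
    invertible. *)
Lemma qform_pencil_gt0 s n (S : 'M[C]_s) (M K : 'M[C]_n) t y :
    0 <= t -> (forall z, 0 <= qform S z) ->
    M \is hermsymmx -> (forall z, z != 0 -> 0 < qform M z) ->
    K \is hermsymmx -> (forall z, 0 <= qform K z) ->
  y != 0 -> 0 < qform (1%:M *t M + t *: (S *t K)) y.
Proof.
move=> t0 S_ge0 Mh M_gt0 Kh K_ge0 y0; rewrite qformD qformZ.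
rewrite ltr_pwDl ?mulr_ge0 ?qform_tens_ge0 //.
have M_ge0 z : 0 <= qform M z by apply: qform_ge0.
have I_gt0 (z : 'rV[C]_s) : z != 0 -> 0 < 'Re (qform 1%:M z).
  by rewrite -qform1_gt0 => z_gt0; rewrite (Creal_ReP _ (gtr0_real z_gt0)).
have IM_ge0 : 0 <= qform (1%:M *t M) y.
  by apply: qform_tens_ge0 => // z; apply: qform1_ge0.
by rewrite -(Creal_ReP _ (ger0_real IM_ge0)) Re_qform_tens_gt0.
Qed.

(** The generalized Rayleigh quotient [lambda = (q + d) / (m + d)]: adding the
    same [d >= 0] to [q] and to its bound [m] preserves [|q| <= m], and can only
    increase the real part of [q]. *)
Lemma tens_pencil_eigenvalue s n (S Q : 'M[C]_s) (M K : 'M[C]_n) t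
    (y : 'rV[C]_(s * n)) lambda :
    0 <= t -> (forall z, 0 <= qform S z) ->
    Q \is unitarymx -> (forall z, z != 0 -> 0 < 'Re (qform Q z)) ->
    M \is hermsymmx -> (forall z, z != 0 -> 0 < qform M z) ->
    K \is hermsymmx -> (forall z, 0 <= qform K z) ->
    y != 0 ->
    y *m (Q *t M + t *: (S *t K))
      = lambda *: (y *m (1%:M *t M + t *: (S *t K))) ->
  0 < 'Re lambda /\ `|lambda| <= 1.
Proof.
move=> t0 S_ge0 Qu Q_gt0 Mh M_gt0 Kh K_ge0 y0 eig.
have M_ge0 z : 0 <= qform M z by apply: qform_ge0.
set q := qform (Q *t M) y; set m := qform (1%:M *t M) y.
set d := t * qform (S *t K) y.
have d_ge0 : 0 <= d by rewrite mulr_ge0 // qform_tens_ge0.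
have q_gt0 : 0 < 'Re q by exact: Re_qform_tens_gt0.
have q_le : `|q| <= m by exact: qform_tens_unitary_le.
have md_gt0 : 0 < m + d.
  by rewrite /m /d -qformZ -qformD qform_pencil_gt0.
have lambdaE : lambda * (m + d) = q + d.
  rewrite /q /m /d -!qformZ -!qformD /qform eig.
  by rewrite -scalemxAl [RHS]mxE.
split.
  rewrite -(pmulr_lgt0 _ md_gt0) -ReMr ?gtr0_real // lambdaE raddfD /=.
  by rewrite ltr_pwDl // (Creal_ReP _ (ger0_real d_ge0)).
rewrite -(ler_pM2r md_gt0) mul1r -{1}(gtr0_norm md_gt0) -normrM lambdaE.
by rewrite (le_trans (ler_normD _ _)) // (ger0_norm d_ge0) lerD2r.
Qed.

End QForm.

(** * Complexification of real forms *)

Section Complexification.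
Local Open Scope sesquilinear_scope.
Local Open Scope complex_scope.
Context {R : rcfType}.

Lemma complexmx_trC m n (A : 'M[R]_(m, n)) : (complexmx A)^t* = complexmx A^T.
Proof. by apply/matrixP => i j; rewrite !mxE; apply: conjc_real. Qed.

(** The cross terms between real and imaginary parts cancel by symmetry, so
    definiteness over the reals passes to the complex form. *)
Lemma qform_complexmx n (N : 'M[R]_n) (y : 'rV[R[i]]_n) :
    N \is symmetricmx ->
  let a := map_mx (@complex.Re R) y in let b := map_mx (@complex.Im R) y in
  qform (complexmx N) y
    = (((a *m N *m a^T) 0 0 + (b *m N *m b^T) 0 0)%R)%:C.
Proof.
move=> /is_hermitianmxP; rewrite expr0 scale1r map_mx_id // => Nsym a b.
have yE : y = complexmx a + 'i%C *: complexmx b.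
  by apply/rowP => j; rewrite !mxE -complexE.
have ycE : y^t* = complexmx a^T - 'i%C *: complexmx b^T.
  apply/colP => j; rewrite !mxE; case: (y 0 j) => u v.
  by rewrite /=; simpc.
have cross : (b *m N *m a^T) 0 0 = (a *m N *m b^T) 0 0.
  have -> : b *m N *m a^T = (a *m N *m b^T)^T.
    by rewrite !trmx_mul trmxK -Nsym mulmxA.
  by rewrite mxE.
have i2 : 'i%C * 'i%C = -1 :> R[i] by rewrite -expr2 sqr_i.
rewrite /qform ycE {1}yE !(mulmxDl, mulmxDr, mulmxN) -!scalemxAl.
rewrite -!scalemxAr -!map_mxM; move: cross; rewrite !mxE => ->.
by rewrite mulrA i2 mulN1r opprK -addrA addNKr -rmorphD.
Qed.

Lemma qform_complexmx_ge0 n (N : 'M[R]_n) y :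
  possemidefmx N -> 0 <= qform (complexmx N) y.
Proof.
case=> Nsym Nge0; rewrite qform_complexmx // ler0c addr_ge0 //.
  by rewrite -{1}[map_mx _ y]trmxK.
by rewrite -{1}[map_mx _ y]trmxK.
Qed.

Lemma posdef_possemidef n (N : 'M[R]_n) : posdefmx N -> possemidefmx N.
Proof.
case=> Nsym Ngt0; split=> // x.
have [->|/Ngt0/ltW//] := eqVneq x 0.
by rewrite mulmx0 mxE.
Qed.

Lemma qform_complexmx_gt0 n (N : 'M[R]_n) y :
  posdefmx N -> y != 0 -> 0 < qform (complexmx N) y.
Proof.
move=> Npd y0; have [Nsym Nge0] := posdef_possemidef Npd.
have [_ Ngt0] := Npd.
have q_ge0 (a : 'rV[R]_n) : 0 <= (a *m N *m a^T) 0 0.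
  by rewrite -{1}[a]trmxK.
have q_gt0 (a : 'rV[R]_n) : a != 0 -> 0 < (a *m N *m a^T) 0 0.
  by move=> a0; rewrite -{1}[a]trmxK; apply: Ngt0; rewrite trmx_eq0.
rewrite qform_complexmx // ltcR.
have [a0|a0] := eqVneq (map_mx (@complex.Re R) y) 0; last first.
  exact: ltr_pwDl (q_gt0 _ a0) (q_ge0 _).
have [b0|b0] := eqVneq (map_mx (@complex.Im R) y) 0; last first.
  exact: ltr_wpDl (q_ge0 _) (q_gt0 _ b0).
case/negP: y0; apply/eqP/rowP => j; rewrite mxE [y 0 j]complexE.
move/rowP/(_ j): a0; move/rowP/(_ j): b0; rewrite !mxE => -> ->.
by rewrite mulr0 addr0.
Qed.

Lemma complexmx_hermitian n (N : 'M[R]_n) :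
  N \is symmetricmx -> complexmx N \is hermsymmx.
Proof.
move=> /is_hermitianmxP; rewrite expr0 scale1r map_mx_id // => Nsym.
apply/is_hermitianmxP; rewrite expr0 scale1r {1}Nsym.
by rewrite complexmx_trC.
Qed.

Lemma complexmx_unitary n (Q : 'M[R]_n) :
  orthogonalmx Q -> complexmx Q \is unitarymx.
Proof.
case=> QQt _; apply/unitarymxP.
by rewrite complexmx_trC -map_mxM QQt map_mx1.
Qed.

(** Rows [z] correspond to the columns [z^*], and the denominator of the Rayleigh
    quotient is positive. *)
Lemma Re_rayleigh_gt0 n (Q : 'M[R[i]]_n) :
    (forall x : 'cV[R[i]]_n, x != 0 -> 0 < complex.Re (rayleigh Q x)) ->
  forall z, z != 0 -> 0 < 'Re (qform Q z).
Proof.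
move=> Qgt0 z z0; have := Qgt0 (map_mx Num.conj z^T).
rewrite map_mx_eq0 trmx_eq0 => /(_ z0); rewrite /rayleigh trmxCK.
rewrite -/(qform Q z) -[z in z *m _]mulmx1 -/(qform 1%:M z).
have q1 : 0 < qform 1%:M z by rewrite qform1_gt0.
rewrite -ltcR complexRe ReMr; last by rewrite gtr0_real ?invr_gt0.
by rewrite pmulr_lgt0 // invr_gt0.
Qed.

Lemma qform_diag_complexmx_ge0 n (S : 'M[R]_n) z :
  is_diag_mx S -> (forall i, 0 <= S i i) -> 0 <= qform (complexmx S) z.
Proof.
move=> /diag_mxP[d ->] S_ge0; rewrite /complexmx map_diag_mx qform_diag.
rewrite sumr_ge0 // => i _; rewrite mulr_ge0 ?exprn_ge0 // mxE ler0c.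
by have := S_ge0 i; rewrite mxE eqxx.
Qed.

End Complexification.

(** * Eigenvalues of the preconditioned matrix *)

(* [eigenvalue] is defined through row eigenvectors; a matrix and its transpose
   have the same eigenvalues. *)
Theorem theorem3p1 (R : rcfType) (s n : nat) (s_gt0 : (0 < s)%N)
    (n_gt0 : (0 < n)%N) (tau : R) (tau_gt0 : 0 < tau)
    (A U Sigma V : 'M[R]_s) (A_unit : A \in unitmx) (A_svd : is_svd A U Sigma V)
    (M K : 'M[R]_n) (M_posdef : posdefmx M) (K_possemidef : possemidefmx K)
    (UV_gt0 : forall x : 'cV[R[i]]_s, x != 0 ->
       0 < complex.Re (rayleigh (complexmx (U^T *m V)) x))
    (lambda : R[i]) :
  eigenvalue
    (complexmx (invmx (rk_precond tau U Sigma V M K) *m rk_matrix tau A M K))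
    lambda ->
  0 < complex.Re lambda /\ `|lambda| <= 1.
Proof.
have [[UUt UtU] [VVt VtV] Sdiag S_ge0 AE] := A_svd.
have M_herm := complexmx_hermitian (proj1 M_posdef).
have K_herm := complexmx_hermitian (proj1 K_possemidef).
have M_gt0 z := qform_complexmx_gt0 (y := z) M_posdef.
have K_ge0 z := qform_complexmx_ge0 z K_possemidef.
set Q := U^T *m V; set t := (real_complex R) tau.
set D := 1%:M *t complexmx M + t *: (complexmx Sigma *t complexmx K).
set N := complexmx Q *t complexmx M + t *: (complexmx Sigma *t complexmx K).
set L := complexmx U *t (1%:M : 'M_n); set T := complexmx V^T *t (1%:M : 'M_n).
have t_ge0 : 0 <= t by rewrite ler0c ltW.
have Q_orth : orthogonalmx Q.
  by split; rewrite trmx_mul trmxK mulmxA;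
    [rewrite -(mulmxA U^T) VVt mulmx1 | rewrite -(mulmxA V^T) UUt mulmx1].
have S_psd z := qform_diag_complexmx_ge0 z Sdiag S_ge0.
have PE : complexmx (rk_precond tau U Sigma V M K) = L *m D *m T.
  rewrite /complexmx /rk_precond !map_mxM map_mxD map_mxZ !mxtens.map_mxT.
  by rewrite !map_mx1.
have BE : complexmx (rk_matrix tau A M K) = L *m N *m T.
  have -> : rk_matrix tau A M K =
      (U *t 1%:M) *m (Q *t M + tau *: (Sigma *t K)) *m (V^T *t 1%:M).
    rewrite mulmxDr mulmxDl -scalemxAr -scalemxAl !mxtens.tensmx_mul.
    by rewrite /rk_matrix !mul1mx !mulmx1 -AE /Q mulmxA UUt mul1mx VVt.
  rewrite /complexmx !map_mxM map_mxD map_mxZ !mxtens.map_mxT.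
  by rewrite !map_mx1.
have D_unit : D \in unitmx.
  by apply: qform_gt0_unit => z; apply: qform_pencil_gt0.
have L_unit : L \in unitmx.
  by rewrite tensmx1_unit // map_unitmx; case: (mulmx1_unit UUt).
have T_unit : T \in unitmx.
  by rewrite tensmx1_unit // map_unitmx; case: (mulmx1_unit VVt).
rewrite /complexmx map_mxM map_invmx -/(complexmx _) -/(complexmx _) PE BE.
case/eigenvalueP => v veig v0.
(* The matching row eigenvector of the reduced pencil is
   [y = v P^-1 (U (x) I)]. *)
set w := v *m invmx (L *m D *m T).
have LDT_unit : L *m D *m T \in unitmx by rewrite !unitmx_mul L_unit D_unit.
have y0 : w *m L != 0.
  by rewrite !mulmx_free_eq0 ?row_free_unit ?unitmx_inv.
have eig : w *m L *m N = lambda *: (w *m L *m D).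
  apply: (can_inj (mulmxK T_unit)); rewrite -scalemxAl.
  have wP : w *m (L *m D *m T) = v by rewrite mulmxKV.
  by move: veig; rewrite mulmxA -/w -wP !mulmxA.
rewrite -ltcR complexRe.
apply: tens_pencil_eigenvalue t_ge0 S_psd _ _ _ _ _ _ y0 eig => //.
  exact: complexmx_unitary.
exact: Re_rayleigh_gt0.
Qed.
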